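(* For any infinite-dimensional Banach space $\mathcal{X}$ (with the metric induced by its norm), $\operatorname{LCJ}(\mathcal{X})=0$.
   Context: Let $a<b$ be real numbers and let $\mathcal{X}=(\mathcal{X},\rho)$ be a metric space. For a map $\gamma\colon[a,b]\to\mathcal{X}$ (no continuity assumed) set $$\operatorname{V}_\gamma=\sup\sum_{i=1}^N\rho(\gamma(t_{i-1}),\gamma(t_i)),$$ the supremum being over all finite tuples $a=t_0<t_1<\dots<t_N=b$. Write $\gamma\in\operatorname{BV}([a,b],\mathcal{X})$ if $\operatorname{V}_\gamma<\infty$. For $f\colon\mathcal{X}\to\mathbb{R}$ let $L_f=\sup_{x_1\neq x_2}|f(x_1)-f(x_2)|/\rho(x_1,x_2)$ be its global Lipschitz constant, and set $$\operatorname{LV}_\gamma=\sup\{\operatorname{V}_{f\circ\gamma} \mid f\colon\mathcal{X}\to\mathbb{R},\ L_f\le 1\}.$$ Define $$\operatorname{LCJ}(\mathcal{X})=\inf\left\{\frac{\operatorname{LV}_\gamma}{\operatorname{V}_\gamma}\ \Big|\ \gamma\in\operatorname{BV}([a,b],\mathcal{X})\right\},$$ the quotient being considered only for $\gamma$ with $\operatorname{V}_\gamma>0$. *)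

(* Defs.v *)
From HB Require Import structures.
From mathcomp Require Import all_boot all_order all_algebra.
From mathcomp Require Import all_classical all_reals all_analysis.

Set Implicit Arguments.
Unset Strict Implicit.
Unset Printing Implicit Defensive.

Import Order.TTheory GRing.Theory Num.Theory.
Import numFieldNormedType.Exports.

Local Open Scope classical_set_scope.
Local Open Scope ring_scope.

(* In the library a normed module is not declared as a metricType, so the metric
   |y - x| induced by the norm is attached to an alias of the carrier. *)
Definition norm_metric (R : realType) (X : normedModType R) : Type := X.

Section norm_metric.
Context (R : realType) (X : normedModType R).

HB.instance Definition _ := PseudoMetric.copy (norm_metric X) X.

Let dist (x y : norm_metric X) : R := `|(y : X) - (x : X)|.

Let dist_ge0 x y : 0 <= dist x y.
Proof. exact: normr_ge0. Qed.

Let dist_positivity x y : dist x y = 0 -> x = y.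
Proof. by move/normr0_eq0/eqP; rewrite subr_eq0 => /eqP. Qed.

Let ballEdist (x : norm_metric X) d : ball x d = [set y | dist x y < d].
Proof.
rewrite (_ : ball x d = ball (x : X) d)// -ball_normE.
by apply/seteqP; split => y /=; rewrite /dist distrC.
Qed.

HB.instance Definition _ :=
  @PseudoMetric_isMetric.Build R (norm_metric X) dist dist_ge0 dist_positivity
    ballEdist.

Lemma norm_metricE (x y : X) :
  mdist (x : norm_metric X) (y : norm_metric X) = `|x - y|.
Proof. exact: distrC. Qed.

End norm_metric.

Section variation.
Context (R : realType).

(* A map on [a, b] is represented by a total function on R; only its values on
   [a, b] matter, since itv_partition a b s says a < s_0 < ... < s_(N-1) = b. *)
Definition mvariation (T : metricType R) (a b : R) (g : R -> T) (s : seq R) : R :=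
  let t := nth b (a :: s) in \sum_(0 <= i < size s) mdist (g (t i)) (g (t i.+1)).

Definition total_mvariation (T : metricType R) (a b : R) (g : R -> T) : \bar R :=
  ereal_sup [set (mvariation a b g s)%:E | s in itv_partition a b].

Definition bounded_mvariation (T : metricType R) (a b : R) (g : R -> T) : Prop :=
  (total_mvariation a b g < +oo)%E.

(* R^o is the real line with its usual metric. *)
Lemma total_mvariation_real (a b : R) (f : R -> R^o) :
  total_mvariation a b f = total_variation a b (f : R -> R).
Proof.
by rewrite /total_mvariation /total_variation /variations [in RHS]image_comp.
Qed.

(* On a space with at most one point this is the supremum of the empty set,
   hence -oo, so that all functions satisfy the bound 1 used below. *)
Definition lipschitz_const (T : metricType R) (f : T -> R^o) : \bar R :=
  ereal_sup [set (mdist (f x.1) (f x.2) / mdist x.1 x.2)%:E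
            | x in [set x : T * T | x.1 <> x.2]].

Definition lipschitz_variation (T : metricType R) (a b : R) (g : R -> T) : \bar R :=
  ereal_sup [set total_mvariation a b (f \o g)
            | f in [set f : T -> R^o | (lipschitz_const f <= 1)%E]].

Definition LCJ (T : metricType R) (a b : R) : \bar R :=
  ereal_inf [set (lipschitz_variation a b g / total_mvariation a b g)%E
            | g in [set g : R -> T | bounded_mvariation a b g /\
                                     (0 < total_mvariation a b g)%E]].

End variation.

Definition finite_dimensional (R : realType) (X : lmodType R) : Prop :=
  exists (n : nat) (e : 'I_n -> X),
    forall x : X, exists c : 'I_n -> R, x = \sum_(i < n) c i *: e i.

(* Main.v *)
Require Import Defs.
From HB Require Import structures.
From mathcomp Require Import all_boot all_order all_algebra.
From mathcomp Require Import all_classical all_reals all_analysis.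
From mathcomp Require Import perm ring lra.

(* The infimum is approached by step functions, so it suffices to find finitely
   many edges (x, y) of X along which every 1-Lipschitz f satisfies
   sum |f x - f y| <= eps * sum |x - y|: a walk running through each edge back
   and forth many times makes the cost of the jumps between edges negligible.

   By the Dvoretzky-Rogers lemma X contains, for each k, vectors v_1, ..., v_k of
   norm between 2/5 and 1 with |sum +-v_i| <= sqrt k for all signs. The edges are
   the (x + K v_i, x), with x ranging over a finite set B almost invariant under
   translations and K large. Let g be the average of f over the translates by a
   finite almost invariant set S. The increments g(x + v_i) - g(x) almost do not
   change when x moves by a signed partial sum of the v_j, so following the signs
   of these increments gives
     sum_i |g(x + v_i) - g(x)| <= |sum +-v_i| + small <= sqrt k + small
   at every x. Telescoping along x, x + v_i, ..., x + K v_i and averaging over B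
   transfers this bound to |g(x + K v_i) - g(x)| / K, and |f - g| is bounded
   independently of K. The bound sqrt k is negligible compared to the total
   length, which is at least 2k/5 per point of B. *)

Set Implicit Arguments.
Unset Strict Implicit.
Unset Printing Implicit Defensive.

Import Order.TTheory GRing.Theory Num.Theory.
Import numFieldNormedType.Exports.

Local Open Scope classical_set_scope.
Local Open Scope ring_scope.

(** * The Dvoretzky-Rogers lemma *)

Definition lincomb (R : realType) (X : lmodType R) (n : nat) (e : 'I_n -> X)
  (c : 'rV[R]_n) : X := \sum_(i < n) c 0 i *: e i.

Lemma lincomb_is_linear (R : realType) (X : lmodType R) n (e : 'I_n -> X) :
  linear (lincomb e).
Proof.
move=> a u v; rewrite /lincomb scaler_sumr -big_split/=.
by apply: eq_bigr => i _; rewrite !mxE scalerDl scalerA.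
Qed.

HB.instance Definition _ (R : realType) (X : lmodType R) n (e : 'I_n -> X) :=
  GRing.isLinear.Build R 'rV[R]_n X _ (lincomb e) (lincomb_is_linear e).

Lemma exists_free (R : realType) (X : lmodType R) (hX : ~ finite_dimensional X)
  (n : nat) : exists e : 'I_n -> X, forall c, lincomb e c = 0 -> c = 0.
Proof.
elim: n => [|n [e eP]].
  by exists (fun=> 0) => c _; apply/rowP => -[].
have [x xP] : exists x, forall c, x <> lincomb e c.
  apply: contrapT => /forallNP h; apply: hX; exists n, e => x.
  have /existsNP[c /contrapT ->] := h x.
  by exists (c 0).
exists (fun i => oapp e x (unlift ord0 i)) => c.
rewrite /lincomb big_ord_recl unlift_none/= => c0.
have {c0} cE : c 0 0 *: x + lincomb e (\row_i c 0 (lift ord0 i)) = 0.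
  rewrite -[RHS]c0; congr (_ + _); apply: eq_bigr => i _.
  by rewrite mxE liftK.
have c00 : c 0 0 = 0.
  apply: contrapT => /eqP c0.
  apply: (xP (- (c 0 0)^-1 *: (\row_i c 0 (lift ord0 i)))).
  rewrite linearZ/= -[LHS](scale1r) -(mulVf c0) -scalerA scaleNr -scalerN.
  by congr (_ *: _); apply/eqP; rewrite -addr_eq0 cE.
move: cE; rewrite c00 scale0r add0r => /eP/rowP cl.
apply/rowP => i; rewrite [RHS]mxE.
by case: (unliftP ord0 i) => [j ->|->//]; have := cl j; rewrite !mxE.
Qed.

(** By freeness, the continuous map [|lincomb e c|] is positive on the unit sphere of the maximum
    norm, which is compact; [C] is the inverse of its minimum there. *)
Lemma lincomb_coercive (R : realType) (X : normedModType R) (n : nat)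
  (e : 'I_n -> X) : (forall c, lincomb e c = 0 -> c = 0) ->
  exists2 C : R, 0 <= C & forall (c : 'rV[R]_n) i, `|c 0 i| <= C * `|lincomb e c|.
Proof.
case: n e => [|n] e eP; first by exists 0 => // c [].
pose S := [set c : 'rV[R]_n.+1 | `|c| = 1].
have S0 : S !=set0.
  have d0 : `|const_mx 1 : 'rV[R]_n.+1| != 0.
    rewrite normr_eq0; apply/eqP => /rowP/(_ 0).
    by rewrite !mxE => /eqP; rewrite oner_eq0.
  exists (`|const_mx 1 : 'rV[R]_n.+1|^-1 *: const_mx 1); rewrite /S/=.
  by rewrite normrZ normfV normr_id mulVf.
have cS : compact S.
  apply: bounded_closed_compact.
    exists 1; split=> // M M1 c; rewrite /S/= => ->; exact: ltW.
  apply: (@preimage_closed _ _ (fun c : 'rV[R]_n.+1 => `|c|) [set x | x = 1]).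
    move=> c _.
    exact: norm_continuous.
  exact: closed_eq.
have cont : continuous (fun c : 'rV[R]_n.+1 => `|lincomb e c|).
  have clin : continuous (lincomb e : 'rV[R]_n.+1 -> X).
    apply: (@continuous_big X 'I_n.+1 +%R 0 xpredT).
      exact: add_continuous.
    move=> i _ c; apply: cvgZr_tmp; first exact: nbhs_filter.
    exact: coord_continuous.
  by move=> c; exact: (continuous_comp (clin c) (@norm_continuous _ X _)).
have [c0 /set_mem Sc0 c0min] := EVT_min_rV S0 cS (continuous_subspaceT cont).
have m0 : 0 < `|lincomb e c0|.
  rewrite normr_gt0; apply/eqP => /eP c00.
  by move: Sc0; rewrite /S/= c00 normr0 => /eqP; rewrite eq_sym oner_eq0.
exists (`|lincomb e c0|^-1); first by rewrite invr_ge0 ltW.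
move=> c i.
have [->|cn0] := eqVneq c 0; first by rewrite mxE normr0 mulr_ge0// invr_ge0.
have nc : 0 < `|c| by rewrite normr_gt0.
apply: (@le_trans _ _ `|c|).
  rewrite [leRHS]/Num.norm/= mx_normrE; apply/bigmax_geP; right.
  by exists (0, i).
rewrite ler_pdivlMl// mulrC -ler_pdivlMl//.
have := c0min (`|c|^-1 *: c).
rewrite linearZ/= normrZ normfV normr_id; apply.
by rewrite inE/= /S/= normrZ normfV normr_id mulVf ?gt_eqF.
Qed.

(** The Euclidean norm; on row vectors [|x|] denotes the maximum norm. *)
Definition enorm (R : realType) n (x : 'rV[R]_n) : R := Num.sqrt ((x *m x^T) 0 0).

Lemma mulmx_trE (R : realType) n (x : 'rV[R]_n) :
  (x *m x^T) 0 0 = \sum_(i < n) x 0 i ^+ 2.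
Proof. by rewrite mxE; apply: eq_bigr => i _; rewrite mxE expr2. Qed.

Lemma mulmx_tr_ge0 (R : realType) n (x : 'rV[R]_n) : 0 <= (x *m x^T) 0 0.
Proof. by rewrite mulmx_trE sumr_ge0// => i _; rewrite sqr_ge0. Qed.

Lemma enormZ (R : realType) n (a : R) (x : 'rV[R]_n) :
  enorm (a *: x) = `|a| * enorm x.
Proof.
rewrite /enorm linearZ/= -scalemxAl -scalemxAr scalerA mxE -expr2.
by rewrite sqrtrM ?sqr_ge0// sqrtr_sqr.
Qed.

Lemma enorm_eq0 (R : realType) n (x : 'rV[R]_n) : enorm x = 0 -> x = 0.
Proof.
move/eqP; rewrite sqrtr_eq0 mulmx_trE => h.
have /eqP : \sum_(i < n) x 0 i ^+ 2 = 0.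
  by apply/eqP; rewrite eq_le h sumr_ge0// => i _; rewrite sqr_ge0.
rewrite psumr_eq0 => [/allP h0|i _]; last exact: sqr_ge0.
apply/rowP => i; rewrite mxE; apply/eqP; rewrite -sqrf_eq0.
exact: h0 (mem_index_enum i).
Qed.

Lemma enorm_coord (R : realType) n (x : 'rV[R]_n) i : `|x 0 i| <= enorm x.
Proof.
rewrite -sqrtr_sqr ler_wsqrtr// mulmx_trE (bigD1 i)//= lerDl sumr_ge0// => j _.
exact: sqr_ge0.
Qed.

Lemma enorm_delta (R : realType) n (i : 'I_n) : enorm (delta_mx 0 i : 'rV[R]_n) = 1.
Proof.
by rewrite /enorm trmx_delta mul_delta_mx mxE !eqxx sqrtr1.
Qed.

(* Sylvester's determinant identity: eliminate either diagonal block of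
   [[1, U], [U^T, 2]]. *)
Lemma det_two_sub_gram (R : realType) j n (U : 'M[R]_(j, n)) : U *m U^T = 1%:M ->
  2 ^+ j * \det (2%:M - U^T *m U) = 2 ^+ n.
Proof.
move=> UU.
have h1 : block_mx 1%:M U U^T 2%:M *m block_mx 1%:M (- U) 0 1%:M =
    block_mx 1%:M 0 U^T (2%:M - U^T *m U).
  by rewrite mulmx_block !mulmx1 !mulmx0 !mul1mx !addr0 mulmxN addNr addrC.
have h2 : block_mx 1%:M U U^T 2%:M *m block_mx 2%:M 0 (- U^T) 1%:M =
    block_mx 1%:M U 0 2%:M.
  rewrite mulmx_block !mulmx1 !mulmx0 !mul1mx !add0r mulmxN UU mul_mx_scalar.
  rewrite mul_scalar_mx scalerN subrr; congr (block_mx _ _ _ _).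
  by rewrite -scalemx1 scaler_nat mulr2n addrK.
move/(congr1 determinant): h1; rewrite det_mulmx !det_ublock det_lblock !det1.
rewrite mulr1 mulr1 mul1r => <-.
move/(congr1 determinant): h2; rewrite det_mulmx det_ublock det_lblock !det1.
by rewrite mulr1 mul1r !det_scalar mulrC.
Qed.

Section ellipsoid.
Context (R : realType) (X : normedModType R) (n : nat) (e : 'I_n -> X).

(** Such an [A] encodes an ellipsoid inside the unit ball of the span of [e], with volume
    proportional to the absolute value of [\det A]. *)
Definition contraction (A : 'M[R]_n) :=
  forall x : 'rV_n, `|lincomb e (x *m A)| <= enorm x.

(** The rows of [A] are the images of Euclidean unit vectors, so coercivity bounds each entry by
    [C], and the Leibniz expansion has n! terms. This makes the supremum of the determinants
    finite. *)
Lemma det_contraction_bounded (C : R) : 0 <= C ->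
  (forall (c : 'rV[R]_n) i, `|c 0 i| <= C * `|lincomb e c|) ->
  forall A, contraction A -> \det A <= (n`!)%:R * C ^+ n.
Proof.
move=> C0 eC A cA.
have AC i j : `|A i j| <= C.
  have := eC (row i A) j; rewrite mxE => /le_trans; apply.
  rewrite -[leRHS]mulr1 ler_wpM2l// rowE (le_trans (cA _))//.
  by rewrite enorm_delta.
rewrite (le_trans (ler_norm _))// (le_trans (ler_norm_sum _ _ _))//.
rewrite (@le_trans _ _ (\sum_(s : 'S_n) C ^+ n))//.
  apply: ler_sum => s _; rewrite normrM normrX normrN1 expr1n mul1r normr_prod.
  rewrite -[X in _ ^+ X]card_ord -prodr_const ler_prod// => i _.
  by rewrite normr_ge0 AC.
by rewrite sumr_const card_Sn -[leLHS]mulr_natl.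
Qed.

Lemma exists_contraction : exists2 A, contraction A & 0 < \det A.
Proof.
pose S := 1 + \sum_(i < n) `|e i|.
have S0 : 0 < S by rewrite ltr_wpDr// sumr_ge0.
exists (S^-1)%:M; last by rewrite det_scalar exprn_gt0// invr_gt0.
move=> x; rewrite mul_mx_scalar linearZ/= normrZ normfV gtr0_norm//.
rewrite ler_pdivrMl// (le_trans (ler_norm_sum _ _ _))//.
rewrite (@le_trans _ _ (\sum_(i < n) `|e i| * enorm x))//.
  by apply: ler_sum => i _; rewrite normrZ mulrC ler_wpM2l// enorm_coord.
by rewrite -mulr_suml ler_wpM2r ?sqrtr_ge0// lerDr.
Qed.

(* With P the orthogonal projection onto the complement of the rows of U, if no
   such y existed then (5/7)(1 + P)A would be a contraction, of determinant at
   least 50/49 * \det A > s, because (5/7)^n * 2^(n-j) >= 50/49 for 2j < n. *)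
Lemma orthonormal_extension (A : 'M[R]_n) (s : R) (j : nat) (U : 'M[R]_(j, n)) :
  contraction A -> (forall B, contraction B -> \det B <= s) ->
  49 / 50 * s < \det A -> 0 < \det A -> U *m U^T = 1%:M -> (j.*2 < n)%N ->
  exists y : 'rV_n, [/\ enorm y = 1, y *m U^T = 0 & 2/5 <= `|lincomb e (y *m A)|].
Proof.
move=> cA sB sA A0 UU jn.
apply: contrapT => /forallNP h.
have hy (y : 'rV_n) : y *m U^T = 0 -> `|lincomb e (y *m A)| <= 2/5 * enorm y.
  move=> yU; have [y0|y0] := eqVneq (enorm y) 0.
    by rewrite y0 mulr0 (enorm_eq0 y0) mul0mx linear0 normr0.
  have ny : 0 < enorm y by rewrite lt_def y0 sqrtr_ge0.
  have := h ((enorm y)^-1 *: y).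
  rewrite enormZ normfV gtr0_norm// mulVf// -!scalemxAl yU scaler0.
  rewrite linearZ/= normrZ normfV gtr0_norm// ler_pdivlMl// => h'.
  by rewrite leNgt; apply/negP => h2; apply: h'; split=> //; rewrite mulrC ltW.
pose P : 'M[R]_n := 1%:M - U^T *m U.
have PU : P *m U^T = 0 by rewrite mulmxBl mul1mx -mulmxA UU mulmx1 subrr.
have nP (x : 'rV_n) : enorm (x *m P) <= enorm x.
  have xE : x = x *m P + x *m U^T *m U by rewrite mulmxBr mulmx1 mulmxA subrK.
  move: xE; set a := x *m P; set z := x *m U^T => xE.
  have aU : a *m (z *m U)^T = 0.
    by rewrite trmx_mul mulmxA -(mulmxA x) PU mulmx0 mul0mx.
  have Ua : z *m U *m a^T = 0 by apply: trmx_inj; rewrite trmx_mul trmxK aU trmx0.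
  have zz : z *m U *m (z *m U)^T = z *m z^T.
    by rewrite trmx_mul mulmxA -(mulmxA z) UU mulmx1.
  rewrite ler_wsqrtr// [in leRHS]xE [(_ + _)^T]linearD mulmxDl !mulmxDr/=.
  by rewrite aU Ua zz addr0 add0r [leRHS]mxE lerDl mulmx_tr_ge0.
(* The image of x under (1 + P)A has norm at most 1 + 2/5 = 7/5 times [enorm x], by [cA] on x and
   [hy] on its projection. *)
pose B := (5 / 7) *: ((1%:M + P) *m A).
have cB : contraction B.
  move=> x; rewrite -scalemxAr linearZ/= normrZ gtr0_norm; last by lra.
  rewrite mulmxA mulmxDr mulmx1 mulmxDl linearD/=.
  have := ler_normD (lincomb e (x *m A)) (lincomb e (x *m P *m A)).
  have := hy (x *m P); rewrite -mulmxA PU mulmx0 => /(_ erefl).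
  have := cA x; have := nP x; lra.
have := sB _ cB; rewrite detZ det_mulmx.
have -> : 1%:M + P = 2%:M - U^T *m U :> 'M[R]_n.
  by rewrite addrA; congr (_ - _); rewrite -[2]/(1 + 1) [RHS]raddfD.
have := det_two_sub_gram UU.
set d := \det (_ - _) => jd dB.
have : 50 / 49 <= (5 / 7) ^+ n * d.
  have [m mE] : exists m, n = (j.*2 + m.+1)%N.
    by exists (n - j.*2).-1; rewrite prednK ?subn_gt0// subnKC// ltnW.
  have -> : d = 2 ^+ j * 2 ^+ m.+1.
    apply: (@mulfI _ (2 ^+ j)); first by rewrite expf_neq0// pnatr_eq0.
    by rewrite jd mE exprD -addnn exprD mulrA.
  have -> : (5 / 7) ^+ n * (2 ^+ j * 2 ^+ m.+1) =
      (50 / 49) ^+ j * (10 / 7) ^+ m.+1 :> R.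
    rewrite mE exprD -mul2n exprM mulrACA -!exprMn; congr (_ ^+ _ * _ ^+ _); lra.
  have h1 : 1 <= (50 / 49 : R) ^+ j by rewrite exprn_ege1//; lra.
  have h2 : 1 <= (10 / 7 : R) ^+ m by rewrite exprn_ege1//; lra.
  rewrite exprS; nra.
move=> h5.
have : 50/49 * \det A <= s by rewrite (le_trans _ dB)// mulrA ler_pM2r.
lra.
Qed.

End ellipsoid.

(* Up to the constants, x |-> lincomb e (x *m A) maps the Euclidean ball onto a
   maximal volume ellipsoid in the unit ball of a 2k-dimensional subspace. *)
Lemma dvoretzky_rogers (R : realType) (X : normedModType R)
  (hX : ~ finite_dimensional X) (k : nat) :
  exists v : 'I_k -> X, (forall i, 2/5 <= `|v i|) /\
    forall s : 'rV[R]_k, `|lincomb v s| <= enorm s.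
Proof.
pose n := k.*2.
have [e /lincomb_coercive[C C0 eC]] := exists_free hX n.
have [A0 cA0 A00] := exists_contraction e.
pose E := [set \det A | A in contraction e].
have supE : has_sup E.
  split; first by exists (\det A0), A0.
  by exists (n`!%:R * C ^+ n) => _ [A cA <-]; exact: det_contraction_bounded.
have s0 : 0 < sup E.
  by apply: lt_le_trans A00 _; apply: ub_le_sup => //; [exact: supE.2|exists A0].
(* A determinant above 49/50 of the supremum is enough, so the supremum need not be shown to be
   attained. *)
have s50 : 0 < sup E / 50 by rewrite divr_gt0.
have [_ [A cA <-] sA] := sup_adherent s50 supE.
(* The rows are added one at a time; while j < k, they span less than half of the 2k dimensions, as
   [orthonormal_extension] requires. *)
have ex_U j : (j <= k)%N -> exists2 U : 'M[R]_(j, n), U *m U^T = 1%:M &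
    forall i, 2/5 <= `|lincomb e (row i U *m A)|.
  elim: j => [|j IH] jk.
    by exists 0; [apply/matrixP => -[]|move=> []].
  have [U UU UA] := IH (ltnW jk).
  have [y [y1 yU yA]] : exists y : 'rV_n,
      [/\ enorm y = 1, y *m U^T = 0 & 2/5 <= `|lincomb e (y *m A)|].
    apply: (@orthonormal_extension _ _ _ e A (sup E)) => //.
    - by move=> B cB; apply: ub_le_sup; [exact: supE.2|exists B].
    - by lra.
    - by lra.
    - by rewrite ltn_double.
  have yy : y *m y^T = 1%:M.
    rewrite [LHS]mx11_scalar; congr scalar_mx.
    by rewrite -[LHS](sqr_sqrtr (mulmx_tr_ge0 y)) -/(enorm y) y1 expr1n.
  have Uy : U *m y^T = 0.
    by apply: trmx_inj; rewrite [LHS]trmx_mul trmxK yU trmx0.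
  exists (col_mx y U : 'M[R]_((1 + j)%N, n)).
    suff : col_mx y U *m (col_mx y U)^T = 1%:M by [].
    by rewrite tr_col_mx mul_col_row yy yU Uy UU scalar_mx_block.
  move=> i; rewrite -(@splitK 1 j i); case: (@fintype.split 1 j i) => {}i/=.
  - suff : 2/5 <= `|lincomb e (row (lshift j i) (col_mx y U) *m A)| by [].
    by rewrite rowKu (ord1 i) row_id.
  - suff : 2/5 <= `|lincomb e (row (rshift 1 i) (col_mx y U) *m A)| by [].
    by rewrite rowKd.
have [U UU UA] := ex_U k (leqnn k).
exists (fun i => lincomb e (row i U *m A)); split=> // s.
have -> : lincomb (fun i => lincomb e (row i U *m A)) s = lincomb e (s *m U *m A).
  rewrite [s *m U]mulmx_sum_row mulmx_suml linear_sum/=; apply: eq_bigr => i _.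
  by rewrite -scalemxAl linearZ.
rewrite (le_trans (cA _))//.
by rewrite /enorm trmx_mul mulmxA -(mulmxA s) UU mulmx1.
Qed.

(** * Almost invariant sets and averaged increments *)

Lemma ler_norm_sum_const (R : realDomainType) (T : Type) (B : seq T)
  (F : T -> R) (c : R) : (forall x, `|F x| <= c) ->
  `|\sum_(x <- B) F x| <= (size B)%:R * c.
Proof.
move=> Fc; rewrite (le_trans (ler_norm_sum _ _ _))//.
rewrite (le_trans (ler_sum _ (fun x _ => Fc x)))//.
by rewrite big_const_seq count_predT iter_addr_0 mulr_natl.
Qed.

(** A Foelner condition, tested against bounded functions instead of symmetric differences, so that
    [B] may have repetitions. *)
Definition almost_invariant (R : realFieldType) (V : zmodType) (S B : seq V) (N : nat) :=
  forall (h : V -> R), (forall x, `|h x| <= 1) -> {in S, forall s,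
    `|\sum_(x <- B) h (x + s) - \sum_(x <- B) h x| <= (size B)%:R * (2 / N%:R)}.

(** For each new s, [B] is replaced by the union of its translates by 0, s, ..., (N-1)s. Translation
    by s then telescopes to two end terms out of N, and translates of [B] inherit the invariance
    under the earlier elements. *)
Lemma exists_almost_invariant (R : realFieldType) (V : zmodType) (S : seq V)
  (N : nat) : (0 < N)%N ->
  exists2 B : seq V, (0 < size B)%N & almost_invariant R S B N.
Proof.
move=> N0; have NR : N%:R != 0 :> R by rewrite pnatr_eq0 -lt0n.
elim: S => [|s S [B B0 IH]]; first by exists [:: 0].
pose B' := [seq x + s *+ n | n <- iota 0 N, x <- B].
have sB' : size B' = (N * size B)%N by rewrite size_allpairs size_iota.
have sumB' (h : V -> R) : \sum_(x <- B') h x =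
    \sum_(0 <= n < N) \sum_(x <- B) h (x + s *+ n).
  by rewrite big_allpairs_dep /index_iota subn0.
have szE : (size B')%:R * (2 / N%:R) = (size B)%:R * 2 :> R.
  by rewrite sB' natrM; field.
exists B'; first by rewrite sB' muln_gt0 N0.
move=> h h1 t; rewrite inE => /orP[/eqP ->|tS].
  rewrite szE !sumB' -sumrB.
  under eq_bigr do rewrite -sumrB.
  rewrite exchange_big/= ler_norm_sum_const// => x.
  have -> : \sum_(0 <= i < N) (h (x + s *+ i + s) - h (x + s *+ i)) =
      h (x + s *+ N) - h x.
    have := telescope_sumr (fun i => h (x + s *+ i)) (leq0n N).
    rewrite mulr0n addr0 => <-.
    by apply: eq_bigr => i _; rewrite -addrA -mulrSr.
  by rewrite (le_trans (ler_normB _ _))// -[2]/(1 + 1) lerD// h1.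
rewrite szE !sumB' -sumrB.
have -> : (size B)%:R * 2 = (size (iota 0 N))%:R * ((size B)%:R * (2 / N%:R)) :> R.
  by rewrite size_iota; field.
rewrite /index_iota subn0; apply: ler_norm_sum_const => n.
under eq_bigr do rewrite addrAC.
exact: (IH (fun y => h (y + s *+ n)) (fun x => h1 _)).
Qed.

Section averaging.
Context (R : realType) (X : normedModType R) (k : nat) (v : 'I_k -> X) (E : R).
Context (v1 : forall i, `|v i| <= 1).
Context (vE : forall s : 'I_k -> bool,
  `|\sum_(i < k) (-1) ^+ s i *: v i| <= E).

Let psum (s : {ffun 'I_k -> bool}) (m : nat) : X :=
  \sum_(i < k | (i < m)%N) (-1) ^+ s i *: v i.

Let psumS s (i : 'I_k) : psum s i.+1 = psum s i + (-1) ^+ s i *: v i.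
Proof.
rewrite /psum (bigD1 i)//= addrC; congr (_ + _); apply: eq_bigl => j.
by rewrite ltnS ltn_neqAle andbC -val_eqE.
Qed.

(** All sign patterns are included because the relevant one depends on f and x, whereas the
    averaging set must be chosen before them. *)
Let shifts : seq X :=
  [seq psum s m | s <- enum {ffun 'I_k -> bool}, m <- iota 0 k.+1].

Let mem_shifts (s : {ffun 'I_k -> bool}) m : (m <= k)%N -> psum s m \in shifts.
Proof. by move=> mk; rewrite allpairs_f ?mem_enum// mem_iota. Qed.

Definition one_lipschitz (f : X -> R) := forall x y, `|f x - f y| <= `|x - y|.

Lemma sum_increments_le (N : nat) (S : seq X) (f : X -> R) :
  almost_invariant R shifts S N -> one_lipschitz f ->
  forall x, \sum_(i < k) `|\sum_(s <- S) (f (x + s + v i) - f (x + s))| <=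
    (size S)%:R * (E + k%:R * (2 / N%:R)).
Proof.
move=> invS lf x.
pose G i := \sum_(s <- S) (f (x + s + v i) - f (x + s)).
pose sg := [ffun i => G i < 0].
pose F m := \sum_(s <- S) f (x + s + psum sg m).
have FG (i : 'I_k) : `|G i| <= F i.+1 - F i + (size S)%:R * (2 / N%:R).
  pose q y := f (x + y + v i) - f (x + y).
  have q1 y : `|q y| <= 1.
    by rewrite (le_trans (lf _ _))// addrAC subrr add0r.
  (* With sign -1 the walk follows [v i] backwards, so the edge in direction [v i] starts at
     [psum sg i.+1]; with sign +1 it starts at [psum sg i]. *)
  have [G0|G0] := ltP (G i) 0.
    rewrite ltr0_norm// -lerBlDl.
    have := invS q q1 _ (mem_shifts sg (ltn_ord i)).
    apply: le_trans; rewrite -/(G i).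
    have -> : F i.+1 - F i = - \sum_(s <- S) q (s + psum sg i.+1).
      rewrite /F -sumrB -sumrN; apply: eq_bigr => s _.
      rewrite /q psumS ffunE G0/= expr1 scaleN1r opprB !addrA.
      by rewrite subrK.
    rewrite opprK addrC.
    by rewrite -/(\sum_(s <- S) q s) ler_norm.
  rewrite ger0_norm// -lerBlDl.
  have := invS q q1 _ (mem_shifts sg (ltnW (ltn_ord i))).
  rewrite distrC; apply: le_trans.
  have -> : F i.+1 - F i = \sum_(s <- S) q (s + psum sg i).
    rewrite /F -sumrB; apply: eq_bigr => s _.
    rewrite /q psumS ffunE ltNge G0/= expr0 scale1r !addrA.
    by [].
  exact: ler_norm.
rewrite (le_trans (ler_sum _ (fun i _ => FG i)))// big_split/= mulrDr lerD//.
  rewrite -(big_mkord xpredT (fun i => F i.+1 - F i)) telescope_sumr//.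
  rewrite /F -sumrB (le_trans (ler_norm _))//.
  apply: ler_norm_sum_const => s; rewrite (le_trans (lf _ _))//.
  have -> : psum sg 0 = 0 by rewrite /psum big_pred0.
  rewrite addr0 addrAC subrr add0r (le_trans _ (vE sg))//.
  by rewrite /psum (eq_bigl xpredT)// => i; rewrite ltn_ord.
by rewrite sumr_const card_ord -mulr_natl; lra.
Qed.

(* Each of the three errors is at most 2/N: moving x in the averaged increments,
   moving l along the edge in the average over B, and replacing f by its average
   over S, which costs 2 * rho / K. *)
Lemma sum_edges_le (N : nat) : (0 < N)%N ->
  exists K (B : seq X), [/\ (0 < K)%N, (0 < size B)%N &
    forall f, one_lipschitz f ->
    \sum_(x <- B) \sum_(i < k) `|f (x + v i *+ K) - f x| <=
      (size B)%:R * (K%:R * (E + k%:R * (6 / N%:R)))].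
Proof.
move=> N0.
have [S S0 invS] := exists_almost_invariant R shifts N0.
pose rho := \sum_(s <- S) `|s|.
have rho0 : 0 <= rho by rewrite sumr_ge0.
(* Hence rho / K <= 1/N: the cost of averaging f does not grow with the edge length, so long edges
   absorb it. *)
pose K := (Num.truncn (rho * N%:R)).+1.
have rhoK : rho * N%:R <= K%:R by rewrite ltW// truncnS_gt.
have [B B0 invB] := exists_almost_invariant R
  [seq v i *+ l | i <- enum 'I_k, l <- iota 0 K] N0.
exists K, B; split=> // f lf.
have NR : 0 < N%:R :> R by rewrite ltr0n.
have SR : 0 < (size S)%:R :> R by rewrite ltr0n.
pose G i x := \sum_(s <- S) (f (x + s + v i) - f (x + s)).
have GE i x : \sum_(s <- S) (f (x + s + v i *+ K) - f (x + s)) =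
    \sum_(l < K) G i (x + v i *+ l).
  rewrite exchange_big/=; apply: eq_bigr => s _.
  have := telescope_sumr (fun l => f (x + s + v i *+ l)) (leq0n K).
  rewrite mulr0n addr0 big_mkord => <-.
  by apply: eq_bigr => l _; rewrite mulrSr addrA !(addrAC _ _ s).
have fG i x : `|f (x + v i *+ K) - f x| * (size S)%:R <=
    \sum_(l < K) `|G i (x + v i *+ l)| + 2 * rho.
  have -> : `|f (x + v i *+ K) - f x| * (size S)%:R =
      `|\sum_(s <- S) (f (x + v i *+ K) - f x)|.
    by rewrite big_const_seq count_predT iter_addr_0 normrMn mulr_natr.
  rewrite mulr_sumr (_ : \sum_(s <- S) _ = \sum_(l < K) G i (x + v i *+ l) +
    \sum_(s <- S) (f (x + v i *+ K) - f (x + s + v i *+ K)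
                   - (f x - f (x + s)))); last first.
    by rewrite -GE -big_split/=; apply: eq_bigr => s _; lra.
  rewrite (le_trans (ler_normD _ _))// lerD// ?ler_norm_sum//.
  rewrite (le_trans (ler_norm_sum _ _ _))//; apply: ler_sum => s _.
  rewrite (le_trans (ler_normB _ _))// mulr_natl mulr2n lerD//.
    by rewrite (le_trans (lf _ _))// (addrAC x s) opprD addrA subrr sub0r normrN.
  by rewrite (le_trans (lf _ _))// opprD addrA subrr sub0r normrN.
have GB i (l : 'I_K) : \sum_(x <- B) `|G i (x + v i *+ l)| <=
   \sum_(x <- B) `|G i x| + (size B)%:R * (size S)%:R * (2 / N%:R).
  (* [G i] is a sum of [size S] increments of absolute value at most 1; dividing gives an admissible
     test function. *)
  have := invB (fun x => `|G i x| / (size S)%:R) _ (v i *+ l) _.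
  rewrite -!mulr_suml -mulrBl normrM normfV (gtr0_norm SR) ler_pdivrMr//.
  move=> /(_ _ _)/(le_trans (ler_norm _)).
  rewrite lerBlDl mulrAC; apply.
    move=> y; rewrite normrM normfV (gtr0_norm SR) ler_pdivrMr// mul1r normr_id.
    rewrite -[leRHS]mulr1; apply: ler_norm_sum_const => s.
    by rewrite (le_trans (lf _ _))// addrAC subrr add0r.
  by apply/allpairsP; exists (i, l : nat); rewrite mem_enum mem_iota ltn_ord.
rewrite -(ler_pM2r SR).
have sumG : \sum_(x <- B) \sum_(i < k) `|G i x| <=
    (size B)%:R * ((size S)%:R * (E + k%:R * (2 / N%:R))).
  rewrite (le_trans (ler_sum _ (fun x _ => sum_increments_le invS lf x)))//.
  by rewrite big_const_seq count_predT iter_addr_0 [leRHS]mulr_natl.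
rewrite (@le_trans _ _ (\sum_(i < k) (K%:R * (\sum_(x <- B) `|G i x| +
  (size B)%:R * (size S)%:R * (2 / N%:R)) + (size B)%:R * (2 * rho))))//.
  rewrite exchange_big mulr_suml/=; apply: ler_sum => i _; rewrite mulr_suml.
  rewrite (le_trans (ler_sum _ (fun x _ => fG i x)))//.
  rewrite big_split/= lerD//.
    rewrite exchange_big/= (le_trans (ler_sum _ (fun l _ => GB i l)))//.
    by rewrite sumr_const card_ord [leRHS]mulr_natl.
  by rewrite big_const_seq count_predT iter_addr_0 [leRHS]mulr_natl.
rewrite big_split/= -mulr_sumr big_split/= !sumr_const card_ord exchange_big/=.
rewrite -[(_ *+ k as X in _ * (_ + X))]mulr_natl -[(_ *+ k as X in _ + X)]mulr_natl.
have -> : 6 / N%:R = 2 / N%:R + 2 / N%:R + 2 / N%:R :> R by lra.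
have rhot : 2 * rho <= K%:R * (2 / N%:R).
  by rewrite mulrCA ler_pM2l// ler_pdivlMr.
(* The term [2 * rho] carries no factor [size S], unlike the other errors; it is enlarged by that
   factor to match them. *)
have S1 : 1 <= (size S)%:R :> R by rewrite ler1n.
have K0 : 0 <= K%:R :> R by [].
have Kt0 : 0 <= K%:R * (2 / N%:R) :> R by rewrite mulr_ge0// divr_ge0// ltW.
have rhotS := le_trans rhot (ler_peMr Kt0 S1).
have := ler_wpM2l (mulr_ge0 (ler0n R k) (ler0n R (size B))) rhotS.
have := ler_wpM2l K0 sumG.
lra.
Qed.

End averaging.

(** * Walks and step functions *)

Lemma exists_contracted_edges (R : realType) (X : normedModType R)
  (hX : ~ finite_dimensional X) (eps : R) : 0 < eps ->
  exists L : seq (X * X), 0 < \sum_(p <- L) `|p.1 - p.2| /\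
    forall f : X -> R, one_lipschitz f ->
      \sum_(p <- L) `|f p.1 - f p.2| <= eps * \sum_(p <- L) `|p.1 - p.2|.
Proof.
move=> eps0.
(* With these choices sqrt k <= eps k/5 and 6k/N <= eps k/5, and their sum is eps times the lower
   bound 2k/5 for the lengths of the [v i]. *)
pose k := (Num.truncn ((5 / eps) ^+ 2)).+1.
pose N := (Num.truncn (30 / eps)).+1.
have kE : Num.sqrt k%:R * Num.sqrt k%:R = k%:R :> R by rewrite -expr2 sqr_sqrtr.
have sk : 5 <= eps * Num.sqrt k%:R.
  have e5 : 0 <= 5 / eps by rewrite divr_ge0// ltW.
  rewrite -ler_pdivrMl// mulrC -[leLHS]ger0_norm// -sqrtr_sqr.
  by rewrite ler_wsqrtr// ltW// truncnS_gt.
have Neps : 6 / N%:R <= eps / 5.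
  have : 30 / eps < N%:R by rewrite truncnS_gt.
  by rewrite ler_pdivrMr ?ltr0n// ltr_pdivrMr//; lra.
have [v [v25 vE]] := dvoretzky_rogers hX k.
have v1 i : `|v i| <= 1.
  have := vE (delta_mx 0 i); rewrite enorm_delta; congr (`| _ | <= _).
  rewrite /lincomb (bigD1 i)//= mxE !eqxx scale1r big1 ?addr0// => j ji.
  by rewrite mxE (negbTE ji) andbF scale0r.
have vs s : `|\sum_(i < k) (-1) ^+ (s i : bool) *: v i| <= Num.sqrt k%:R.
  have := vE (\row_i (-1) ^+ s i); rewrite /enorm mulmx_trE.
  congr (`| _ | <= Num.sqrt _); first by apply: eq_bigr => i _; rewrite mxE.
  under eq_bigr do rewrite mxE sqrr_sign.
  by rewrite sumr_const card_ord.
have [K [B [K0 B0 KB]]] := sum_edges_le v1 vs (ltn0Sn _ : (0 < N)%N).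
pose L := [seq (x + v i *+ K, x) | x <- B, i <- enum 'I_k].
have LE (h : X * X -> R) : \sum_(p <- L) h p =
    \sum_(x <- B) \sum_(i < k) h (x + v i *+ K, x).
  by rewrite big_allpairs_dep; apply: eq_bigr => x _; rewrite big_enum.
have c0 : 0 < (size B)%:R * (K%:R * (k%:R * (2 / 5))) :> R.
  by rewrite !mulr_gt0 ?divr_gt0 ?ltr0n.
have Llen : (size B)%:R * (K%:R * (k%:R * (2 / 5))) <= \sum_(p <- L) `|p.1 - p.2|.
  rewrite LE/=.
  under eq_bigr do under eq_bigr do rewrite addrAC subrr add0r normrMn.
  rewrite big_const_seq count_predT iter_addr_0 -[leRHS]mulr_natl ler_wpM2l//.
  rewrite sumrMnl -[leRHS]mulr_natl ler_wpM2l//.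
  rewrite -[k in leLHS]card_ord mulr_natl -sumr_const.
  by apply: ler_sum => i _.
exists L; split; first exact: lt_le_trans Llen.
move=> f lf; apply: (@le_trans _ _
    (eps * ((size B)%:R * (K%:R * (k%:R * (2 / 5)))))); last first.
  by rewrite ler_wpM2l// ltW.
rewrite LE/= (le_trans (KB f lf))//.
rewrite [leRHS]mulrCA ler_wpM2l// [leRHS]mulrCA ler_wpM2l//.
have := ler_wpM2l (ler0n R k) Neps.
have := ler_wpM2l (sqrtr_ge0 k%:R) sk.
rewrite mulrCA kE; lra.
Qed.

Section walk.
Context (R : numDomainType) (X : Type).

Fixpoint walk_length (d : X -> X -> R) (x : X) (s : seq X) : R :=
  if s is y :: s' then d x y + walk_length d y s' else 0.

Fixpoint jump_length (d : X -> X -> R) (x : X) (L : seq (X * X)) : R :=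
  if L is p :: L' then d x p.1 + jump_length d p.2 L' else 0.

(** Each edge is traversed 2m+1 times. The count is odd, so the walk leaves from [p.2] and the jumps
    do not depend on m. *)
Definition edge_walk (m : nat) (L : seq (X * X)) : seq X :=
  flatten [seq flatten (nseq m.+1 [:: p.1; p.2]) | p <- L].

Lemma walk_length_edge_walk (d : X -> X -> R) m x L : (forall x y, d x y = d y x) ->
  walk_length d x (edge_walk m L) =
  jump_length d x L + (2 * m + 1)%:R * \sum_(p <- L) d p.1 p.2.
Proof.
move=> dC; elim: L x => [|p L IH] x/=; first by rewrite big_nil mulr0 addr0.
rewrite big_cons.
have blk j s : walk_length d p.2 (flatten (nseq j [:: p.1; p.2]) ++ s) =
    (2 * j)%:R * d p.1 p.2 + walk_length d p.2 s.
  elim: j => [|j IHj]/=; first by rewrite muln0 mul0r add0r.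
  by rewrite IHj (dC p.2) mulnS natrD; ring.
rewrite -/(edge_walk m L) blk IH natrD; ring.
Qed.

Lemma ler_jump_length (d d' : X -> X -> R) x L : (forall x y, d x y <= d' x y) ->
  jump_length d x L <= jump_length d' x L.
Proof. by move=> dd'; elim: L x => //= p L IH x; rewrite lerD. Qed.

Lemma walk_lengthE (d : X -> X -> R) x0 x s : walk_length d x s =
  \sum_(0 <= i < size s) d (nth x0 (x :: s) i) (nth x0 (x :: s) i.+1).
Proof.
elim: s x => [|y s IH] x /=; first by rewrite big_geq.
by rewrite big_nat_recl//= IH.
Qed.

End walk.

Lemma mvariationE (R : realType) (T : metricType R) (a b : R) (g : R -> T) s :
  mvariation a b g s = walk_length (fun x y => mdist (g x) (g y)) a s.
Proof. by rewrite (walk_lengthE _ b). Qed.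

Lemma mdist_le_sum (R : realType) (T : metricType R) (u : nat -> T) m n :
  (m <= n)%N -> mdist (u m) (u n) <= \sum_(m <= i < n) mdist (u i) (u i.+1).
Proof.
elim: n => [|n IH].
  by rewrite leqn0 => /eqP ->; rewrite mdistxx big_geq.
rewrite leq_eqVlt => /orP[/eqP ->|]; first by rewrite mdistxx big_geq.
rewrite ltnS => mn; rewrite big_nat_recr//=.
by rewrite (le_trans (metric_triangle _ (u n) _))// lerD2r IH.
Qed.

Section step_function.
Context (R : realType) (a b : R) (hab : a < b) (N : nat) (N0 : (0 < N)%N).

(** The cells are closed on the left and [idx b] is [N], so on [a, b] a step function takes the N+1
    values u 0, ..., u N, the last one at b alone. *)
Let idx (t : R) : nat := Num.truncn (N%:R * ((t - a) / (b - a))).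
Let node (i : nat) : R := a + (b - a) * (i%:R / N%:R).

Let NR : 0 < N%:R :> R. Proof. by rewrite ltr0n. Qed.
Let ba : 0 < b - a. Proof. by rewrite subr_gt0. Qed.

Let idx_node i : idx (node i) = i.
Proof.
rewrite /idx /node -[RHS](@natrK R); congr Num.truncn.
by field; rewrite !gt_eqF// subr_gt0.
Qed.

Let nodeN : node N = b.
Proof. by rewrite /node divff ?gt_eqF// mulr1 addrC subrK. Qed.

Let node0 : node 0 = a.
Proof. by rewrite /node mul0r mulr0 addr0. Qed.

Let idx_homo s t : s <= t -> (idx s <= idx t)%N.
Proof.
move=> st; apply: le_truncn.
by rewrite ler_wpM2l// ler_wpM2r ?invr_ge0 ?(ltW ba)// lerD2r.
Qed.

Let nodes := [seq node i.+1 | i <- iota 0 N].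

Let nth_nodes i : (i <= N)%N -> nth b (a :: nodes) i = node i.
Proof.
case: i => [|i] iN /=; first by rewrite node0.
by rewrite (nth_map 0%N) ?size_iota// nth_iota.
Qed.

Definition step_function (T : Type) (u : nat -> T) (t : R) : T := u (idx t).

(** Along any partition [idx] is nondecreasing, so the triangle inequality bounds each term by a
    block of consecutive steps of u; the partition into nodes attains the bound. *)
Lemma total_mvariation_step (T : metricType R) (u : nat -> T) :
  total_mvariation a b (step_function u) =
    (\sum_(0 <= i < N) mdist (u i) (u i.+1))%:E.
Proof.
apply/eqP; rewrite eq_le; apply/andP; split.
  apply: ge_ereal_sup => _ [s [sp /eqP sb] <-]; rewrite lee_fin mvariationE.
  suff walk_le c : path <%R c s ->
      walk_length (fun x y => mdist (u (idx x)) (u (idx y))) c s <=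
      \sum_(idx c <= i < idx (last c s)) mdist (u i) (u i.+1).
    have idxa : idx a = 0%N by rewrite -{1}node0 idx_node.
    have idxb : idx b = N by rewrite -{1}nodeN idx_node.
    by have := walk_le _ sp; rewrite sb idxa idxb.
  elim: s c {sp sb} => [|t s IH] c /=; first by rewrite big_geq.
  move=> /andP[ct ts].
  have ts' : t <= last t s.
    elim: s t {IH ct} ts => //= y s IH t /andP[ty /IH]; exact/le_trans/ltW.
  rewrite (big_cat_nat (idx_homo (ltW ct)) (idx_homo ts'))/=.
  by rewrite lerD ?IH// mdist_le_sum// idx_homo// ltW.
apply: ereal_sup_ubound; exists nodes.
  split; last first.
    by rewrite (last_nth b) size_map size_iota nth_nodes// nodeN.
  apply/(pathP b) => i; rewrite size_map size_iota => iN.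
  rewrite (nth_nodes (ltnW iN)); have /= -> := nth_nodes iN.
  by rewrite ltrD2l ltr_pM2l// ltr_pM2r ?invr_gt0// ltr_nat.
rewrite /mvariation size_map size_iota; congr (_%:E).
apply: eq_big_nat => i /andP[_ iN].
by rewrite !nth_nodes ?(ltnW iN)// /step_function !idx_node.
Qed.

End step_function.

(** * Variation ratios of step functions along edge walks *)

Lemma lipschitz_const_le1 (R : realType) (X : normedModType R)
  (f : norm_metric X -> R^o) : (lipschitz_const f <= 1)%E ->
  one_lipschitz (f : X -> R).
Proof.
move=> f1 x y; have [->|xy] := eqVneq x y; first by rewrite !subrr !normr0.
have xy0 : 0 < `|x - y| by rewrite normr_gt0 subr_eq0.
have : ((mdist (f x) (f y) / mdist (x : norm_metric X) y)%:E <= 1)%E.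
  apply: le_trans f1; apply: ereal_sup_ubound; exists (x, y) => //=.
  exact/eqP.
by rewrite lee_fin norm_metricE ler_pdivrMr// mul1r [mdist _ _]distrC.
Qed.

Theorem corollary1p4 (R : realType) (a b : R) (hab : (a < b)%R)
  (X : completeNormedModType R) (hX : ~ finite_dimensional X) :
  LCJ (norm_metric X) a b = 0%E.
Proof.
apply/eqP; rewrite eq_le; apply/andP; split; last first.
  apply: le_ereal_inf_tmp => _ [g [gfin g0] <-].
  rewrite mule_ge0 ?inve_ge0 ?(ltW g0)//.
  (* A constant function is admissible, so the numerator is a supremum over a nonempty set and is
     nonnegative. *)
  pose f0 : norm_metric X -> R^o := fun=> 0.
  apply: (@le_trans _ _ (total_mvariation a b (f0 \o g))).
    apply: (@le_trans _ _ (mvariation a b (f0 \o g) [:: b])%:E).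
      by rewrite lee_fin sumr_ge0// => i _; exact: mdist_ge0.
    by apply: ereal_sup_ubound; exists [:: b] => //; rewrite /itv_partition/= hab.
  apply: ereal_sup_ubound; exists f0 => //.
  apply: ge_ereal_sup => _ [xy _ <-]; rewrite lee_fin.
  by rewrite mdistxx mul0r.
apply/lee_addgt0Pr => eps eps0; rewrite add0e.
(* One half of eps pays for the edges, the other for the jumps between them. *)
have e20 : 0 < eps / 2 by rewrite divr_gt0.
have [L [L0 Lf]] := exists_contracted_edges hX e20.
pose x0 : X := 0.
pose dX (x y : X) := `|x - y|.
have dXC x y : dX x y = dX y x by rewrite /dX distrC.
pose len := \sum_(p <- L) `|p.1 - p.2|.
pose J := jump_length dX x0 L.
have J0 : 0 <= J.
  by rewrite /J; elim: (L) (x0) => //= p L' IH x; rewrite addr_ge0// normr_ge0.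
(* Enough repetitions to make the jumps at most eps/2 times the length walked along edges; the image
   of the jumps under f is bounded only by [J]. *)
pose m := (Num.truncn (J / (eps / 2 * len))).+1.
have Jm : J <= eps / 2 * ((2 * m + 1)%:R * len).
  have c0 : 0 < eps / 2 * len by rewrite mulr_gt0.
  have : J / (eps / 2 * len) < m%:R by rewrite truncnS_gt.
  rewrite ltr_pdivrMr// natrD natrM => Jc; nra.
pose P := edge_walk m L.
pose y := nth x0 (x0 :: P).
have N0 : (0 < size P)%N.
  by rewrite /P; case: (L) L0 => [|p L'] //=; rewrite big_nil ltxx.
pose gam : R -> norm_metric X := step_function a b (size P) y.
have Vgam : total_mvariation a b gam = (J + (2 * m + 1)%:R * len)%:E.
  rewrite total_mvariation_step//; congr (_%:E).
  rewrite -(walk_length_edge_walk m x0 L dXC) (walk_lengthE _ x0).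
  by apply: eq_bigr => i _; rewrite norm_metricE.
have W0 : 0 < (2 * m + 1)%:R * len by rewrite mulr_gt0// ltr0n addn1.
have V0 : 0 < J + (2 * m + 1)%:R * len by rewrite ltr_wpDl.
apply: ge_ereal_inf.
exists (lipschitz_variation a b gam / total_mvariation a b gam)%E.
  by exists gam => //; split; rewrite /bounded_mvariation Vgam ?ltry// lte_fin.
rewrite Vgam inver gt_eqF// lee_pdivrMr//.
rewrite -EFinM; apply: ge_ereal_sup => _ [f /lipschitz_const_le1 lf <-].
have -> : f \o gam = step_function a b (size P) (fun i => f (y i)) by [].
rewrite total_mvariation_step// lee_fin.
pose df (x y : X) : R := `|f x - f y|.
have -> : \sum_(0 <= i < size P) mdist (f (y i)) (f (y i.+1)) =
    walk_length df x0 P.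
  by rewrite (walk_lengthE _ x0); apply: eq_bigr => i _; rewrite /df distrC.
rewrite walk_length_edge_walk; last by move=> u w; rewrite /df distrC.
rewrite (@le_trans _ _ (J + (2 * m + 1)%:R * (eps / 2 * len)))//.
  by rewrite lerD ?ler_wpM2l ?Lf// ler_jump_length.
nra.
Qed.
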